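(* Let $n\ge 2$ be an integer, let $r>0$, let $\overline B_r\subset\mathbb R^n$ be a closed ball of radius $r$, and let $f:\overline B_r\to\mathbb R$ be a $C^2$ function. Let $M=\{(x,f(x)) : x\in\overline B_r\}\subset\mathbb R^{n+1}$ be its graph, with mean curvature $H$ and (normalized) scalar curvature $R$. Then $$\inf_M|R|\le\Big(\sup_M|H|+\frac1r\Big)\frac2r .$$ Moreover, if $M$ has a point at which the second fundamental form is semi-definite, then $$\inf_M|R|<\frac1{r^2}.$$
   Context: A $C^2$ function on a closed ball is understood to be $C^2$ up to the boundary (i.e. it is the restriction of a $C^2$ function defined on an open neighborhood of the closed ball). The graph $M$ is oriented by a choice of continuous unit normal field. Let $A$ denote the shape operator of $M$ and $k_1(p)\le\dots\le k_n(p)$ the principal curvatures (eigenvalues of $A$) at $p\in M$. The mean curvature is $H=\frac1n\sum_{i=1}^n k_i$. The scalar curvature is normalized and given by the Gauss equation as $R=\frac{2}{n(n-1)}\sum_{1\le i<j\le n}k_ik_j$ (so a sphere of radius $a$ has $R=1/a^2$). The second fundamental form is semi-definite at $p$ if the principal curvatures $k_1(p),\dots,k_n(p)$ are all $\ge 0$ or all $\le 0$. *)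

(* Defs.v *)
From HB Require Import structures.
From mathcomp Require Import all_boot all_order all_algebra.
From mathcomp Require Import all_classical all_reals all_analysis.
Import Order.TTheory GRing.Theory Num.Theory numFieldNormedType.Exports.

Set Implicit Arguments.
Unset Strict Implicit.
Unset Printing Implicit Defensive.

Local Open Scope classical_set_scope.
Local Open Scope ring_scope.

Section Euclidean.
Context {R : realType}.

(* The norm carried by 'rV[R]_n in the library is the sup norm; it induces
   the usual topology, but lengths and balls must be the Euclidean ones. *)
Definition dot {n} (u v : 'rV[R]_n) : R := \sum_(i < n) u 0 i * v 0 i.

Definition enorm {n} (u : 'rV[R]_n) : R := Num.sqrt (dot u u).

Definition eclosed_ball {n} (c : 'rV[R]_n) (r : R) : set 'rV[R]_n :=
  [set x | enorm (x - c) <= r].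

Definition partial {n m} (F : 'rV[R]_n -> 'rV[R]_m) (i : 'I_n) (x : 'rV[R]_n) :
  'rV[R]_m := 'D_(delta_mx 0 i) F x.

Definition grad {n} (f : 'rV[R]_n -> R) (x : 'rV[R]_n) : 'rV[R]_n :=
  \row_i 'D_(delta_mx 0 i) f x.

(* f is differentiable on U, its derivative is differentiable on U, and the
   second derivative is continuous on U (used with U open). *)
Definition C2_on {n} (U : set 'rV[R]_n) (f : 'rV[R]_n -> R) : Prop :=
  [/\ forall x, U x -> differentiable f x,
      forall x, U x -> differentiable (grad f) x &
      forall x, U x -> {for x, continuous (jacobian (grad f))}].

End Euclidean.

Section GraphGeometry.
Context {R : realType} {n : nat}.
Implicit Types (f : 'rV[R]_n -> R) (x : 'rV[R]_n) (B : set 'rV[R]_n).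
Implicit Types N : 'rV[R]_(n + 1) -> 'rV[R]_(n + 1).

Definition graph_map f x : 'rV[R]_(n + 1) := row_mx x (f x)%:M.

Definition graph_on f B : set 'rV[R]_(n + 1) := graph_map f @` B.

(* N is a continuous unit normal field on the graph of f over B; the tangent
   space at graph_map f x is spanned by the partial (graph_map f) i x. *)
Definition unit_normal_field f B N : Prop :=
  {within graph_on f B, continuous N} /\
  forall x, B x ->
    enorm (N (graph_map f x)) = 1 /\
    forall i, dot (partial (graph_map f) i x) (N (graph_map f x)) = 0.

(* All the quantities below are taken at the point graph_map f x of the graph,
   in the basis (partial (graph_map f) i x)_i of the tangent space. *)
Definition first_form f x : 'M[R]_n :=
  \matrix_(i, j) dot (partial (graph_map f) i x) (partial (graph_map f) j x).

Definition second_form f N x : 'M[R]_n :=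
  \matrix_(i, j) dot (partial (partial (graph_map f) i) j x)
                     (N (graph_map f x)).

(* The endomorphism A of the tangent space given by <A v, w> = II(v, w).  On
   row vectors of coordinates it is v |-> v *m A, so that A *m g = II where g
   is the first fundamental form, a positive definite matrix. *)
Definition shape_operator f N x : 'M[R]_n :=
  second_form f N x *m invmx (first_form f x).

(* The eigenvalues of A, in nondecreasing order and with multiplicity.  They
   exist and are unique when f is C^2 near x, since A is then self-adjoint for
   the first fundamental form: the default value is never used. *)
Definition principal_curvatures f N x : n.-tuple R :=
  xget (nseq_tuple n 0)
    [set k : n.-tuple R | sorted <=%R k /\
       char_poly (shape_operator f N x) = \prod_(a <- k) ('X - a%:P)].

Definition mean_curvature f N x : R :=
  n%:R^-1 * \sum_(i < n) tnth (principal_curvatures f N x) i.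

Definition scalar_curvature f N x : R :=
  2 / (n%:R * (n%:R - 1)) *
  \sum_(i < n) \sum_(j < n | (i < j)%N)
    tnth (principal_curvatures f N x) i * tnth (principal_curvatures f N x) j.

Definition semidefinite_at f N x : Prop :=
  (forall i, 0 <= tnth (principal_curvatures f N x) i) \/
  (forall i, tnth (principal_curvatures f N x) i <= 0).

End GraphGeometry.

(* Main.v *)
Require Import Defs.
From HB Require Import structures.
From mathcomp Require Import all_boot all_order all_algebra.
From mathcomp Require Import all_classical all_reals all_analysis.
From mathcomp Require Import complex ring lra.
Import Order.TTheory GRing.Theory Num.Theory numFieldNormedType.Exports.

Local Open Scope classical_set_scope.
Local Open Scope ring_scope.

(* Let rho > r be so close to r that a lower hemisphere of radius rho centred on
   the axis over c is, above the boundary of the ball, steeper than M.  Lower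
   the hemisphere from above until it first touches M: the contact takes place
   over an interior point x, and comparing second derivatives there shows that
   the principal curvatures with respect to the upward normal satisfy
   k_i <= 1 / rho.  Turning the hemisphere upside down gives k_i >= - 1 / rho.
   If R vanishes somewhere both claims are clear; otherwise R has a constant
   sign.  If R > 0, then H has no zero because R <= H ^ 2, so it has a constant
   sign; touching from the appropriate side gives |H| <= 1 / rho at x, hence
   R <= 1 / rho ^ 2 < 1 / r ^ 2.  If R < 0 there is no semi-definite point, and
   summing the products of the nonnegative numbers 1 / rho - k_i gives
   - R <= 1 / rho ^ 2 + 2 |H| / rho at x. *)

(** * Linear algebra: the spectrum of a real symmetric matrix *)

Lemma char_poly_conj (K : comUnitRingType) n (V A : 'M[K]_n) :
  V \in unitmx -> char_poly (invmx V *m A *m V) = char_poly A.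
Proof.
move=> Vu; rewrite /char_poly.
have -> : char_poly_mx (invmx V *m A *m V) =
    map_mx (@polyC K) (invmx V) *m char_poly_mx A *m map_mx (@polyC K) V.
  rewrite /char_poly_mx mulmxBr mulmxBl -!map_mxM; congr (_ - _).
  by rewrite scalar_mxC -mulmxA -map_mxM mulVmx // map_mx1 mulmx1.
by rewrite !det_mulmx mulrC mulrA -det_mulmx -map_mxM mulmxV // map_mx1 det1 mul1r.
Qed.

(** Over [R[i]] the matrix is Hermitian, hence unitarily diagonalisable with real eigenvalues; the
    identities then descend along the injection of [R] into [R[i]]. *)
Lemma symmetric_char_poly (R : rcfType) n (S : 'M[R]_n) : S^T = S ->
  exists d : 'I_n -> R,
    [/\ char_poly S = \prod_i ('X - (d i)%:P), \tr S = \sum_i d i &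
        \tr (S *m S) = \sum_i d i ^+ 2].
Proof.
move=> Ssym; pose toC := real_complex R; pose A := map_mx toC S.
have Aherm : A \is hermsymmx.
  apply: realsym_hermsym.
    by apply/is_hermitianmxP; rewrite expr0 scale1r map_mx_id // /A map_trmx Ssym.
  by apply/mxOverP => i j; rewrite mxE; apply/complex_realP; exists (S i j).
have dreal := hermitian_spectral_diag_real Aherm.
have /hermitian_normalmx/orthomx_spectralP := Aherm.
set V := spectralmx A; set e := spectral_diag A => AE.
have Vu : V \in unitmx by exact: spectral_unit.
pose d i := complex.Re (e 0 i).
have dE i : toC (d i) = e 0 i.
  by apply: RRe_real; exact: (mxOverP dreal).
have trA (B : 'M[R[i]]_n) : \tr (invmx V *m B *m V) = \tr B.
  by rewrite mxtrace_mulC mulmxA mulmxV // mul1mx.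
have toCI : injective toC := @complexI R.
have toC_sum (F : 'I_n -> R) : toC (\sum_i F i) = \sum_i toC (F i).
  exact: rmorph_sum.
have toCM a b : toC (a * b) = toC a * toC b by exact: rmorphM.
exists d; split.
- apply: (@map_inj_poly _ _ toC (@complexI R) (rmorph0 _)).
  rewrite map_char_poly -/A AE char_poly_conj // char_poly_trig ?diag_mx_is_trig //.
  rewrite rmorph_prod; apply: eq_bigr => i _.
  rewrite rmorphB /= map_polyX map_polyC /= mxE eqxx mulr1n.
  by congr ('X - _%:P); exact/esym/dE.
- apply: toCI; rewrite -[LHS]trace_map_mx -/A AE trA mxtrace_diag.
  by rewrite toC_sum; apply: eq_bigr => i _; exact/esym/dE.
- apply: toCI; rewrite -[LHS]trace_map_mx map_mxM -/A AE.
  rewrite !mulmxA mulmxK // -[invmx V *m _ *m _]mulmxA trA mulmx_diag mxtrace_diag.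
  by rewrite toC_sum; apply: eq_bigr => i _; rewrite mxE -[e 0 i]dE -toCM expr2.
Qed.

Lemma rV_sqr_ge0 (R : realDomainType) n (v : 'rV[R]_n) : 0 <= (v *m v^T) 0 0.
Proof. by rewrite mxE sumr_ge0 // => i _; rewrite mxE -expr2 sqr_ge0. Qed.

Lemma rV_sqr_eq0 (R : realDomainType) n (v : 'rV[R]_n) :
  ((v *m v^T) 0 0 == 0) = (v == 0).
Proof.
apply/idP/eqP => [|->]; last by rewrite mul0mx mxE.
rewrite mxE psumr_eq0 => [/allP v0|i _]; last by rewrite mxE -expr2 sqr_ge0.
apply/rowP => i; have := v0 i (mem_index_enum i).
by rewrite !mxE /= mulf_eq0 orbb => /eqP.
Qed.

(** * The metric [1 + p^T p] of a graph with gradient [p] *)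

Section RankOneMetric.
Context {R : rcfType} {n : nat}.
Variable p : 'rV[R]_n.
Let q := (p *m p^T) 0 0.
Let X := p^T *m p.

Lemma rank_one_sqr : X *m X = q *: X.
Proof.
rewrite /X mulmxA -[_ *m p^T]mulmxA [p *m p^T]mx11_scalar mul_mx_scalar.
by rewrite -scalemxAl.
Qed.

(** As [X *m X = q *: X], matrices of this form are closed under products, so inverting the metric
    and taking its square root become scalar equations. *)
Lemma rank_one_affine_mul (a b : R) :
  (1%:M + a *: X) *m (1%:M + b *: X) = 1%:M + (a + b + a * b * q) *: X.
Proof.
rewrite mulmxDl mul1mx mulmxDr mulmx1 -scalemxAl -scalemxAr rank_one_sqr.
by rewrite !scalerA -!addrA -!scalerDl; congr (_ + _ *: _); ring.
Qed.

Lemma invmx_rank_one : invmx (1%:M + X) = (1 + q)^-1 *: ((1 + q)%:M - X).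
Proof.
have q1 : 1 + q != 0 by rewrite lt0r_neq0 // ltr_pwDl // rV_sqr_ge0.
have -> : (1 + q)^-1 *: ((1 + q)%:M - X) = 1%:M + - (1 + q)^-1 *: X.
  by rewrite scalerBr scale_scalar_mx mulVf // scaleNr.
have g1 : (1%:M + X) *m (1%:M + - (1 + q)^-1 *: X) = 1%:M.
  rewrite -{1}[X]scale1r rank_one_affine_mul.
  by rewrite [Y in Y *: _](_ : _ = 0) ?scale0r ?addr0 //; field.
have [gu _] := mulmx1_unit g1.
by rewrite -[LHS]mulmx1 -[Y in _ *m Y = _]g1 mulKmx.
Qed.

Lemma rank_one_sqrt : exists Q : 'M[R]_n, Q^T = Q /\ Q *m (1%:M + X) *m Q = 1%:M.
Proof.
have q0 : 0 < 1 + q by rewrite ltr_pwDl // rV_sqr_ge0.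
pose W := Num.sqrt (1 + q).
have W0 : 0 < W by rewrite sqrtr_gt0.
have qE : q = W ^+ 2 - 1 by rewrite sqr_sqrtr ?ltW // addrC addKr.
(* The inverse square root of the metric must multiply [p] by [1 / W] and fix its orthogonal
   complement. As [q = (W - 1) * (W + 1)], this is the coefficient, written without dividing by [q],
   which may vanish. *)
exists (1%:M + - (W * (W + 1))^-1 *: X); split.
  by rewrite linearD /= trmx1 linearZ /= /X trmx_mul trmxK.
rewrite -{2}[X]scale1r !rank_one_affine_mul.
rewrite [Y in Y *: _](_ : _ = 0) ?scale0r ?addr0 // qE.
by field; rewrite !lt0r_neq0 // addr_gt0.
Qed.

(** With [Q] the inverse square root of the metric, [A] is conjugate to the symmetric matrix
    [Q *m B *m Q], so its spectrum is real. The last clause turns an inequality of quadratic forms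
    into a bound on eigenvalues. *)
Lemma shape_spectrum (B : 'M[R]_n) : B^T = B ->
  let A := B *m invmx (1%:M + X) in
  exists d : 'I_n -> R,
    [/\ char_poly A = \prod_i ('X - (d i)%:P), \sum_i d i = \tr A,
        \sum_i d i ^+ 2 = \tr (A *m A) &
        forall s k, (forall v : 'rV_n,
            s * (v *m B *m v^T) 0 0 <= k * (v *m (1%:M + X) *m v^T) 0 0) ->
          forall i, s * d i <= k].
Proof.
move=> Bsym A; have [Q [Qsym QgQ]] := rank_one_sqrt.
have [Qu _] : Q \in unitmx /\ (1%:M + X) *m Q \in unitmx.
  by apply: mulmx1_unit; rewrite mulmxA.
have gQQ : (1%:M + X) *m (Q *m Q) = 1%:M.
  by rewrite mulmxA; apply: mulmx1C; rewrite mulmxA.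
have [gu _] := mulmx1_unit gQQ.
have iE : invmx (1%:M + X) = Q *m Q.
  by rewrite -[LHS]mulmx1 -[Y in _ *m Y = _]gQQ mulKmx.
have [S SE] : exists S, S = Q *m B *m Q by eexists.
have Ssym : S^T = S by rewrite SE !trmx_mul Qsym Bsym mulmxA.
have AE : A = invmx Q *m S *m Q by rewrite /A iE SE !mulmxA mulVmx ?mul1mx.
have trE (M : 'M[R]_n) : \tr (invmx Q *m M *m Q) = \tr M.
  by rewrite mxtrace_mulC mulmxA mulmxV // mul1mx.
have [d [dchar dtr dtr2]] := symmetric_char_poly _ _ _ Ssym.
exists d; split.
- by rewrite AE char_poly_conj.
- by rewrite AE trE dtr.
- by rewrite AE !mulmxA mulmxK // -[invmx Q *m S *m S]mulmxA trE dtr2.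
move=> s k sk i.
have /eigenvalueP[v vS v0] : eigenvalue S (d i).
  rewrite eigenvalue_root_char dchar (bigD1 i) //=.
  by rewrite rootM root_XsubC eqxx.
(* For an eigenvector [v] of [S], at [v *m Q] the form [B] takes the value [d i] times the squared
   length of [v], and the metric takes that squared length. *)
have := sk (v *m Q).
rewrite trmx_mul Qsym !mulmxA -[v *m Q *m B]mulmxA.
rewrite -[v *m (Q *m B) *m Q]mulmxA -SE vS -scalemxAl mxE.
rewrite -[v *m Q *m _]mulmxA -[v *m _ *m Q]mulmxA QgQ mulmx1 mulrA ler_pM2r //.
by rewrite lt_def rV_sqr_eq0 v0 rV_sqr_ge0.
Qed.

End RankOneMetric.

(** * Sums of squares and sums of products *)

Lemma sum_lt_mul_sqr (R : comNzRingType) n (F : 'I_n -> R) :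
  (\sum_(i < n) \sum_(j < n | (i < j)%N) F i * F j) *+ 2 =
  (\sum_i F i) ^+ 2 - \sum_i F i ^+ 2.
Proof.
have swap : \sum_(i < n) \sum_(j < n | (i < j)%N) F i * F j =
            \sum_(i < n) \sum_(j < n | (j < i)%N) F i * F j.
  rewrite (exchange_big_dep predT) //=; apply: eq_bigr => i _.
  by apply: eq_bigr => j _; rewrite mulrC.
apply/eqP; rewrite eq_sym subr_eq; apply/eqP.
rewrite expr2 big_distrlr /= mulr2n {2}swap -!big_split /=.
apply: eq_bigr => i _.
rewrite (bigD1 i) //= (bigID (fun j : 'I_n => (i < j)%N)) /=.
rewrite -expr2 addrC; congr (_ + _ + _); apply: eq_bigl => j;
  by rewrite -val_eqE /=; case: ltngtP.
Qed.

Lemma sum_sqr_le_sqr_sum (R : realDomainType) n (F : 'I_n -> R) :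
  (forall i, 0 <= F i) -> \sum_i F i ^+ 2 <= (\sum_i F i) ^+ 2.
Proof.
move=> F0; rewrite -subr_ge0 -sum_lt_mul_sqr mulrn_wge0 //.
by apply: sumr_ge0 => i _; apply: sumr_ge0 => j _; rewrite mulr_ge0.
Qed.

(** The sum of the squared deviations from the mean [m] is nonnegative. *)
Lemma sqr_sum_le (R : realFieldType) n (F : 'I_n -> R) :
  (\sum_i F i) ^+ 2 <= n%:R * \sum_i F i ^+ 2.
Proof.
case: n F => [|n] F; first by rewrite !big_ord0 mulr0 expr0n.
pose m := (\sum_i F i) / n.+1%:R.
have : 0 <= \sum_i (F i - m) ^+ 2 by apply: sumr_ge0 => i _; apply: sqr_ge0.
under eq_bigr do rewrite sqrrB.
rewrite big_split /= sumrB sumrMnl -mulr_suml sumr_const card_ord.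
rewrite -[m ^+ 2 *+ _]mulr_natl.
have -> : \sum_i F i = n.+1%:R * m by rewrite mulrC divfK // pnatr_eq0.
have n0 : 0 < n.+1%:R :> R by rewrite ltr0n.
clearbody m; move: (n.+1%:R) n0 (\sum_i _) => N N0 s h.
by have := mulr_ge0 (ltW N0) h; lra.
Qed.

(** * Differential calculus in coordinates *)

Section Calculus.
Context {R : realType}.

Lemma dotE n (u v : 'rV[R]_n) : dot u v = (u *m v^T) 0 0.
Proof. by rewrite mxE; apply: eq_bigr => i _; rewrite mxE. Qed.

Lemma dotC n (u v : 'rV[R]_n) : dot u v = dot v u.
Proof. by apply: eq_bigr => i _; rewrite mulrC. Qed.

Lemma dot_linearP n a (u v w : 'rV[R]_n) : dot (a *: u + v) w = a * dot u w + dot v w.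
Proof. by rewrite !dotE mulmxDl -scalemxAl !mxE. Qed.

Lemma dotDl n (u v w : 'rV[R]_n) : dot (u + v) w = dot u w + dot v w.
Proof. by rewrite !dotE mulmxDl !mxE. Qed.

Lemma dotZl n a (u w : 'rV[R]_n) : dot (a *: u) w = a * dot u w.
Proof. by rewrite !dotE -scalemxAl !mxE. Qed.

Lemma dotNl n (u w : 'rV[R]_n) : dot (- u) w = - dot u w.
Proof. by rewrite -scaleN1r dotZl mulN1r. Qed.

Lemma dot_ge0 n (u : 'rV[R]_n) : 0 <= dot u u.
Proof. by rewrite dotE rV_sqr_ge0. Qed.

Lemma dot_delta n (i : 'I_n) (u : 'rV[R]_n) : dot (delta_mx 0 i) u = u 0 i.
Proof.
rewrite /dot (bigD1 i) //= big1 => [|j ji]; first by rewrite mxE !eqxx mul1r addr0.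
by rewrite mxE eqxx (negbTE ji) mul0r.
Qed.

Lemma dot_line n (y v : 'rV[R]_n) s :
  dot (y + s *: v) (y + s *: v) = dot y y + s * (2 * dot y v + s * dot v v).
Proof.
rewrite dotDl ![dot _ (_ + _)]dotC !dotDl !dotZl.
rewrite ![dot _ (_ *: v)]dotC !dotZl [dot v y]dotC; ring.
Qed.

Lemma rank_one_form n (p v : 'rV[R]_n) :
  (v *m (1%:M + p^T *m p) *m v^T) 0 0 = dot v v + dot p v ^+ 2.
Proof.
rewrite mulmxDr mulmx1 mulmxDl mxE -dotE; congr (_ + _).
by rewrite mulmxA -mulmxA mxE big_ord1 -!dotE dotC -expr2.
Qed.

Lemma dot_continuous n (w : 'rV[R]_n) : continuous (fun u => dot u w).
Proof.
apply: continuous_big => [|i _]; first exact: add_continuous.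
suff c : continuous (fun u : 'rV[R]_n => u 0 i * w 0 i) by exact: c.
move=> u; apply: (@continuousM _ _ (fun u : 'rV[R]_n => u 0 i) (cst (w 0 i))).
  exact: coord_continuous.
exact: cst_continuous.
Qed.

Lemma is_diff_dot n (w u : 'rV[R]_n) : is_diff u (fun x => dot x w) (fun x => dot x w).
Proof.
have dot_lin : linear (fun x => dot x w) by move=> a x y; exact: dot_linearP.
pose dotM := GRing.isLinear.Build _ _ _ _ _ dot_lin.
pose dotL : {linear 'rV[R]_n -> R} := HB.pack (fun x => dot x w) dotM.
have dotLc : continuous dotL by exact: dot_continuous.
by apply: DiffDef; [exact: (@linear_differentiable _ _ _ dotL) |
                    exact: (@diff_lin _ _ _ dotL)].
Qed.

Lemma diff_dot_grad n (f : 'rV[R]_n -> R) x v :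
  differentiable f x -> 'd f x v = dot (grad f x) v.
Proof.
move=> df; rewrite [v in LHS]row_sum_delta linear_sum.
apply: eq_bigr => i _; rewrite linearZ /= mxE mulrC; congr (_ * _).
by rewrite deriveE.
Qed.

Lemma is_derive_line n (W : normedModType R) (F : 'rV[R]_n -> W) x v (t : R) :
  differentiable F (x + t *: v) ->
  is_derive t 1 (fun s => F (x + s *: v)) ('d F (x + t *: v) v).
Proof.
move=> dF; pose l (s : R) := x + s *: v.
have dl : is_diff t l ( *:%R ^~ v).
  have := is_diffD (is_diff_cst x t) (is_diff_scalel t v).
  by rewrite add0r.
have [dFl dFlE] := is_diff_comp dl (differentiableP dF).
apply: DeriveDef; first exact/diff_derivable/dFl.
by rewrite deriveE; [rewrite dFlE /= scale1r | exact: dFl].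
Qed.

Section C2.
Context {n : nat} (U : set 'rV[R]_n) (f : 'rV[R]_n -> R).
Hypotheses (hU : open U) (hf : C2_on U f).
Let hess x := jacobian (grad f) x.

Lemma is_derive_line_grad x v (t : R) : U (x + t *: v) ->
  is_derive t 1 (fun s => f (x + s *: v)) (dot (grad f (x + t *: v)) v).
Proof.
have [df _ _] := hf => /df dfx; rewrite -diff_dot_grad //.
exact: is_derive_line.
Qed.

Lemma is_derive_line_hess x v w (t : R) : U (x + t *: v) ->
  is_derive t 1 (fun s => dot (grad f (x + s *: v)) w)
    (dot (v *m hess (x + t *: v)) w).
Proof.
have [_ dg _] := hf => /dg dgx.
have [gw gwE] := is_diff_comp (differentiableP dgx) (is_diff_dot _ w _).
have := @is_derive_line _ _ (fun y => dot (grad f y) w) x v t gw.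
by rewrite gwE /= -deriveE // deriveEjacobian.
Qed.

Lemma near_line x v : U x -> \forall t \near (0 : R), U (x + t *: v).
Proof.
move=> Ux; have : (fun t : R => x + t *: v) @ 0 --> x + 0 *: v.
  by apply: cvgD; [exact: cvg_cst | exact: scalel_continuous].
rewrite scale0r addr0; apply; exact: open_nbhs_nbhs.
Qed.

Lemma near_shift_open x : U x -> \forall w \near (0 : 'rV[R]_n), U (w + x).
Proof.
move=> Ux; have : (fun w => w + x) @ (0 : 'rV[R]_n) --> 0 + x.
  apply: (@continuousD _ _ _ id (cst x)); last exact: cst_continuous.
  exact: (fun A => id).
by rewrite add0r; apply; exact: open_nbhs_nbhs.
Qed.

(* The mean value theorem is applied in the direction [u] only, so that
   differentiability of the gradient at [x] alone suffices. *)
Lemma second_difference x u v (eps : R) : U x -> 0 < eps ->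
  exists2 d : R, 0 < d & forall t, 0 < t -> t < d ->
    `|f (x + t *: v + t *: u) - f (x + t *: u) - (f (x + t *: v) - f x)
      - t ^+ 2 * dot (v *m hess x) u| <= eps * t ^+ 2.
Proof.
move=> Ux eps0; pose G y := dot (grad f y) u.
have [_ /(_ _ Ux) dg _] := hf.
have [dG dGE] := is_diff_comp (differentiableP dg) (is_diff_dot _ u _).
(* For [s] and [a] in [[0, t]] the vector [s *: u + a *: v] has norm at most [t * C]. Each of two
   linearisation errors is then at most [eps * t / 2], and a factor [t] comes from the mean value
   theorem. *)
pose C := `|u| + `|v| + 1.
have C0 : 0 < C by rewrite ltr_wpDl // addr_ge0.
have e0 : 0 < eps / (2 * C) by rewrite divr_gt0 // mulr_gt0.
have /eqaddoP/(_ _ e0) Go := diff_locally dG.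
have /nbhs_ballP[r /= r0 hr] : \forall w \near (0 : 'rV[R]_n), U (w + x) /\
    `|G (w + x) - G x - dot (w *m hess x) u| <= eps / (2 * C) * `|w|.
  near=> w; split; first by near: w; exact: near_shift_open.
  have -> : G (w + x) - G x - dot (w *m hess x) u =
      ((G \o shift x) - (cst (G x) + 'd G x)) w.
    rewrite !fctE /= opprD addrA dGE /= -deriveE // deriveEjacobian //.
  by near: w.
exists (r / C) => [|t t0 tr]; first by rewrite divr_gt0.
have c0 : 0 \in `[0, t]%R by rewrite bound_itvE ltW.
have ct : t \in `[0, t]%R by rewrite bound_itvE ltW.
have inr s a : s \in `[0, t]%R -> a \in `[0, t]%R ->
    `|s *: u + a *: v| <= t * C /\ ball (0 : 'rV[R]_n) r (s *: u + a *: v).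
  rewrite !in_itv /= => /andP[s0 st] /andP[a0 at_].
  have le : `|s *: u + a *: v| <= t * C.
    rewrite (le_trans (ler_normD _ _)) // !normrZ !ger0_norm // /C !mulrDr mulr1.
    by apply: ler_wpDr; [exact: ltW | apply: lerD; exact: ler_wpM2r].
  split => //; rewrite -ball_normE /ball_ /= sub0r normrN (le_lt_trans le) //.
  by rewrite -ltr_pdivlMr.
(* The increment of [k] over [[0, t]] is the mixed second difference. *)
pose k s := f (x + t *: v + s *: u) - f (x + s *: u).
have shE s a : x + a *: v + s *: u = s *: u + a *: v + x.
  by rewrite -addrA addrC [a *: v + _]addrC.
have sh0 s : x + s *: u = s *: u + 0 *: v + x by rewrite scale0r addr0 addrC.
have dk s : s \in `[0, t]%R ->
    is_derive (s : R) 1 k (G (x + t *: v + s *: u) - G (x + s *: u)).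
  move=> st; apply: is_deriveB; apply: is_derive_line_grad.
  - by rewrite shE; have [_ /hr[]] := inr s t st ct.
  - by rewrite sh0; have [_ /hr[]] := inr s 0 st c0.
have [|s st kE] := @MVT _ k _ 0 t t0 (fun s hs => dk s (subset_itv_oo_cc hs)).
  by apply: derivable_within_continuous => s /dk[].
have {}st := subset_itv_oo_cc st.
have [n1 /hr[_ h1]] := inr s t st ct.
have [n2 /hr[_ h2]] := inr s 0 st c0.
have -> : f (x + t *: v + t *: u) - f (x + t *: u) - (f (x + t *: v) - f x) = k t - k 0.
  by rewrite /k !scale0r !addr0.
rewrite kE subr0 shE sh0.
set w1 := s *: u + t *: v in n1 h1 *; set w2 := s *: u + 0 *: v in n2 h2 *.
have -> : (G (w1 + x) - G (w2 + x)) * t - t ^+ 2 * dot (v *m hess x) u =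
    t * ((G (w1 + x) - G x - dot (w1 *m hess x) u) -
         (G (w2 + x) - G x - dot (w2 *m hess x) u)).
  rewrite /w1 /w2 scale0r addr0 mulmxDl -!scalemxAl dotDl !dotZl.
  move: (G _) (G _) (G x) => G1 G2 G3; ring.
rewrite normrM ger0_norm ?(ltW t0) //.
have -> : eps * t ^+ 2 = t * (eps / (2 * C) * (t * C) + eps / (2 * C) * (t * C)).
  by field; rewrite gt_eqF.
rewrite ler_pM2l // (le_trans (ler_normB _ _)) // lerD //.
  by rewrite (le_trans h1) // ler_pM2l.
by rewrite (le_trans h2) // ler_pM2l.
Unshelve. all: by end_near. Qed.

(** The second difference is symmetric in [u] and [v], and it approximates both mixed second
    derivatives. *)
Lemma hess_sym x : U x -> (hess x)^T = hess x.
Proof.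
move=> Ux.
have le u v : dot (v *m hess x) u <= dot (u *m hess x) v.
  rewrite leNgt; apply/negP => lt.
  (* A third of the gap: the two errors together stay below the gap. *)
  have e0 : 0 < (dot (v *m hess x) u - dot (u *m hess x) v) / 3.
    by rewrite divr_gt0 // subr_gt0.
  have [d1 d10 h1] := second_difference _ u v _ Ux e0.
  have [d2 d20 h2] := second_difference _ v u _ Ux e0.
  pose t := Num.min d1 d2 / 2.
  have t0 : 0 < t by rewrite divr_gt0 // lt_min d10.
  have : t < Num.min d1 d2 by rewrite ltr_pdivrMr // ltr_pMr ?ltr1n // lt_min d10.
  rewrite lt_min => /andP[td1 td2].
  have := h1 _ t0 td1; have := h2 _ t0 td2.
  rewrite -[x + t *: u + t *: v]addrA [t *: u + _]addrC addrA !ler_norml.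
  move=> /andP[_ ?] /andP[? _].
  have : 0 < t ^+ 2 * (dot (v *m hess x) u - dot (u *m hess x) v).
    by rewrite mulr_gt0 ?exprn_gt0 // subr_gt0.
  lra.
have sym u v : dot (v *m hess x) u = dot (u *m hess x) v.
  by apply/eqP; rewrite eq_le !le.
apply/matrixP => i j; rewrite mxE.
have := sym (delta_mx 0 i) (delta_mx 0 j).
by rewrite -!rowE ![dot (row _ _) _]dotC !dot_delta ![row _ _ _ _]mxE.
Qed.

End C2.

(** The conclusion is one-sided so as to apply also at a boundary point of the ball, along a line
    entering it. *)
Lemma derive_lt0_decr (h : R -> R) (d : R) : is_derive (0 : R) 1 h d -> d < 0 ->
  exists2 e : R, 0 < e & forall t, 0 < t -> t < e -> h t < h 0.
Proof.
move=> [dh dhE] d0.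
have : (t^-1 *: (h (t *: 1 + 0) - h 0)) @[t --> (0 : R)^'] --> d.
  by rewrite -dhE; exact: dh.
move=> /cvgr_lt /(_ _ d0); rewrite near_withinE => /nbhs_ballP[e /= e0 he].
exists e => // t t0 te; have /he : ball (0 : R) e t.
  by rewrite /ball /= sub0r normrN gtr0_norm.
rewrite addr0 /GRing.scale /= mulr1 pmulr_rlt0 ?invr_gt0 // subr_lt0.
by apply; rewrite gt_eqF.
Qed.

Lemma second_derivative_test (h h' : R -> R) (d : R) :
  (\forall t \near (0 : R), is_derive (t : R) 1 h (h' t)) ->
  is_derive (0 : R) 1 h' d ->
  (\forall t \near (0 : R), h 0 <= h t) -> h' 0 = 0 /\ 0 <= d.
Proof.
move=> dh dh' hmin.
have /nbhs_ballP[e /= e0 he] : \forall t \near (0 : R),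
  is_derive (t : R) 1 h (h' t) /\ h 0 <= h t by near do split.
have inb t : t \in `]- e, e[%R -> ball (0 : R) e t.
  by rewrite /ball /= sub0r normrN in_itv /= ltr_norml.
have h'0 : h' 0 = 0.
  have [[_ <-] _] := he 0 (ballxx _ e0).
  have [|t /inb/he[[]]|||_ ->] // := @derive1_at_min _ h (- e) e 0.
  - by rewrite lerNl (le_trans _ (ltW e0)) // oppr_le0 ltW.
  - by rewrite in_itv /= oppr_lt0 e0.
  - by move=> t /inb/he[].
split => //; rewrite leNgt; apply/negP => d0.
(* If [d < 0], then [h'] is negative just to the right of [0], so [h] falls strictly below its
   minimum [h 0] there. *)
have [e' e'0 he'] := derive_lt0_decr _ _ dh' d0.
pose m := Num.min e e' / 2.
have m0 : 0 < m by rewrite divr_gt0 // lt_min e0.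
have : m < Num.min e e' by rewrite /m ltr_pdivrMr // ltr_pMr ?ltr1n // lt_min e0.
rewrite lt_min => /andP[me me'].
have inm t : t \in `[0, m]%R -> ball (0 : R) e t.
  move=> tm; rewrite /ball /= sub0r normrN ger0_norm ?(itvP tm) //.
  by rewrite (le_lt_trans _ me) // (itvP tm).
have : h m < h 0.
  apply: (@ltr0_derive1_lt_cc _ h 0 m); rewrite ?bound_itvE ?(ltW m0) //.
  - by move=> t /subset_itv_oo_cc /inm/he[[]].
  - move=> t tm; have [hd _] := he _ (inm t (subset_itv_oo_cc tm)).
    by rewrite derive1E derive_val -h'0 he' ?(le_lt_trans _ me') ?(itvP tm).
  - by apply: derivable_within_continuous => t /inm/he[[]].
apply/negP; rewrite -leNgt; have /inm/he[] // : m \in `[0, m]%R.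
by rewrite bound_itvE ltW.
Unshelve. all: by end_near. Qed.

Lemma continuous_dot n (T : topologicalType) (F G : T -> 'rV[R]_n) x :
  {for x, continuous F} -> {for x, continuous G} ->
  {for x, continuous (fun y => dot (F y) (G y))}.
Proof.
move=> cF cG.
apply: (@cvg_big _ _ _ _ _ _ _ (nbhs x)) => [|i _]; first exact: add_continuous.
have cc (H : T -> 'rV[R]_n) : {for x, continuous H} ->
    {for x, continuous (fun y => H y 0 i)}.
  move=> cH; apply: (@continuous_comp _ _ _ H (fun M : 'rV[R]_n => M 0 i) x cH).
  exact: coord_continuous.
by apply: cvgM; exact: cc.
Qed.

Lemma cauchy_schwarz n (u v : 'rV[R]_n) : dot u v ^+ 2 <= dot u u * dot v v.
Proof.
have [->|v0] := eqVneq v 0.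
  by rewrite !dotE trmx0 !mulmx0 !mxE mulr0 expr0n.
have vv : 0 < dot v v by rewrite lt_def dot_ge0 dotE rV_sqr_eq0 v0.
have := dot_ge0 _ (dot v v *: u - dot u v *: v).
rewrite dotDl dotNl !dotZl ![dot _ (_ - _)]dotC !dotDl !dotNl !dotZl [dot v u]dotC.
move=> h; rewrite -(ler_pM2l vv) -subr_ge0; lra.
Qed.

Lemma eclosed_ballP n (c : 'rV[R]_n) r x : 0 <= r ->
  eclosed_ball c r x <-> dot (x - c) (x - c) <= r ^+ 2.
Proof.
move=> r0; rewrite /eclosed_ball /= /enorm -{1}[r]ger0_norm // -sqrtr_sqr.
by rewrite ler_sqrt // sqr_ge0.
Qed.

Lemma continuous_sqr_dist n (c : 'rV[R]_n) :
  continuous (fun x : 'rV[R]_n => dot (x - c) (x - c)).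
Proof.
move=> x.
have cB : {for x, continuous (fun y : 'rV[R]_n => y - c)}.
  apply: (@continuousD _ _ _ id (cst (- c)) x); last exact: cst_continuous.
  exact: (fun A => id).
exact: (continuous_dot _ _ _ _ _ cB cB).
Qed.

Lemma compact_eclosed_ball n (c : 'rV[R]_n) r : 0 <= r -> compact (eclosed_ball c r).
Proof.
move=> r0.
have -> : eclosed_ball c r =
    (fun x : 'rV[R]_n => dot (x - c) (x - c)) @^-1` [set y | y <= r ^+ 2].
  by apply/seteqP; split => x /=; rewrite -eclosed_ballP.
apply: bounded_closed_compact; last first.
  by apply: closed_comp => [x _|]; [exact: continuous_sqr_dist | exact: closed_le].
exists (r + `|c|); split; first by rewrite num_real.
move=> M hM x /= xr; apply: le_trans (ltW hM).
rewrite -[x](subrK c) (le_trans (ler_normD _ _)) // lerD2r.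
(* Boundedness refers to the sup norm; each coordinate is at most the Euclidean length. *)
rewrite [leLHS]/Num.Def.normr /= mx_normrE; apply: bigmax_le => // -[i j] _ /=.
rewrite ord1 -[leRHS]ger0_norm // -ler_sqr ?nnegrE // real_normK ?num_real //.
rewrite real_normK ?num_real // (le_trans _ xr) // /dot (bigD1 j) //= expr2 lerDl.
by apply: sumr_ge0 => k _; rewrite -expr2 sqr_ge0.
Qed.

End Calculus.

(** The function is the squared distance from a point of the graph to the centre of the sphere,
    along a line: the quadratic is the horizontal part, and [F] is the height. *)
Lemma is_derive_quad_sqr {R : realType} (F : R -> R) (A B C D a t : R) :
  is_derive t 1 F D ->
  is_derive t 1 (fun s => A + s * (2 * B + s * C) + (F s - a) ^+ 2)
    (2 * (B + t * C) + 2 * ((F t - a) * D)).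
Proof.
move=> dF.
have dFa : is_derive t 1 (fun s => F s - a) (D - 0) by exact: is_deriveB.
have dy : is_derive t 1 (fun s => A + s * (2 * B + s * C))
    (0 + (t * (0 + (t * 0 + C * 1)) + (2 * B + t * C) * 1)).
  by apply: is_deriveD; apply: is_deriveM; apply: is_deriveD; apply: is_deriveM.
have [dh dhE] := is_deriveD dy (is_deriveM dFa dFa).
have -> : (fun s => A + s * (2 * B + s * C) + (F s - a) ^+ 2) =
    (fun s => A + s * (2 * B + s * C) + (F s - a) * (F s - a)).
  by apply/funext => s; rewrite expr2.
by apply: (DeriveDef dh); rewrite [LHS]dhE /GRing.scale /=; ring.
Qed.

(** With [G] the derivative of [F], this gives the second derivative of the squared distance. *)
Lemma is_derive_affine_mul {R : realType} (F G : R -> R) (B C D E a t : R) :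
  is_derive t 1 F D -> is_derive t 1 G E ->
  is_derive t 1 (fun s => 2 * (B + s * C) + 2 * ((F s - a) * G s))
    (2 * C + 2 * (D * G t + (F t - a) * E)).
Proof.
move=> dF dG.
have dFa : is_derive t 1 (fun s => F s - a) (D - 0) by exact: is_deriveB.
have dy : is_derive t 1 (fun s => B + s * C) (0 + (t * 0 + C * 1)).
  by apply: is_deriveD; apply: is_deriveM.
have c2 : is_derive t 1 (cst (2 : R) : R -> R) 0 by exact: is_derive_cst.
have [dh dhE] := is_deriveD (is_deriveM c2 dy) (is_deriveM c2 (is_deriveM dFa dG)).
by apply: (DeriveDef dh); rewrite [LHS]dhE !scaler0 /GRing.scale /=; ring.
Qed.

(** * The touching sphere *)

Section Touching.
Context {R : realType} {n : nat} (U : set 'rV[R]_n) (f : 'rV[R]_n -> R).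
Hypotheses (hU : open U) (hf : C2_on U f).
Variables (c : 'rV[R]_n) (r : R).
Hypotheses (hr : 0 < r) (hBU : eclosed_ball c r `<=` U).
Let hess x := jacobian (grad f) x.

Lemma C2_continuous x : U x -> {for x, continuous f}.
Proof. by have [df _ _] := hf => /df /differentiable_continuous. Qed.

Lemma C2_continuous_grad x : U x -> {for x, continuous (grad f)}.
Proof. by have [_ dg _] := hf => /dg /differentiable_continuous. Qed.

Lemma eclosed_ball_center : eclosed_ball c r c.
Proof.
apply/eclosed_ballP; first exact: ltW.
by rewrite subrr dotE mul0mx mxE sqr_ge0.
Qed.

Lemma continuous_within_ball (g : 'rV[R]_n -> R) :
  (forall x, U x -> {for x, continuous g}) ->
  {within eclosed_ball c r, continuous g}.
Proof.
move=> cg; apply: continuous_in_subspaceT => x.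
by rewrite inE => /hBU /cg.
Qed.

Lemma grad_bounded : exists2 M : R, 0 < M &
  forall x, eclosed_ball c r x -> dot (grad f x) (grad f x) < M.
Proof.
have [|||m _ hm] := @EVT_max_rV R n
  (fun x => dot (grad f x) (grad f x)) (eclosed_ball c r).
- by exists c; exact: eclosed_ball_center.
- exact/compact_eclosed_ball/ltW.
- apply: continuous_within_ball => x /C2_continuous_grad cx.
  exact: (continuous_dot _ _ _ _ _ cx cx).
exists (dot (grad f m) (grad f m) + 1).
  by rewrite ltr_pwDr // dot_ge0.
by move=> x Bx; rewrite (le_lt_trans (hm x _)) ?ltrDl // inE.
Qed.

(* The sphere has centre [(c, a)], above M if [e = 1] and below it if
   [e = - 1].  The last clause says that over the boundary of the ball it is
   steeper than M. *)
Lemma touching_sphere (e : R) : e ^+ 2 = 1 ->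
  exists (rho : R) (x0 : 'rV[R]_n) (a : R), r < rho /\ [/\ eclosed_ball c r x0,
    0 < e * (a - f x0),
    dot (x0 - c) (x0 - c) + (f x0 - a) ^+ 2 = rho ^+ 2,
    forall x, eclosed_ball c r x ->
      rho ^+ 2 <= dot (x - c) (x - c) + (f x - a) ^+ 2 &
    dot (x0 - c) (x0 - c) = r ^+ 2 ->
      (f x0 - a) ^+ 2 * dot (grad f x0) (grad f x0) < r ^+ 2].
Proof.
move=> e2; have [M M0 hM] := grad_bounded.
(* Over the boundary the hemisphere has squared slope [r ^+ 2 / (rho ^+ 2 - r ^+ 2)]. This [del]
   makes it equal to [M], which exceeds the squared slope of the graph. *)
pose del := r ^+ 2 / M; have del0 : 0 < del by rewrite divr_gt0 // exprn_gt0.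
pose rho := Num.sqrt (r ^+ 2 + del).
have rhoE : rho ^+ 2 = r ^+ 2 + del by rewrite sqr_sqrtr // addr_ge0 ?sqr_ge0 ?ltW.
pose y x := dot (x - c) (x - c).
pose s x := Num.sqrt (rho ^+ 2 - y x).
have ys x : eclosed_ball c r x -> 0 < rho ^+ 2 - y x.
  move=> /eclosed_ballP => /(_ (ltW hr)) xr.
  by rewrite rhoE subr_gt0 (le_lt_trans xr) ?ltrDl.
(* The first contact is where [s x + e * f x] is largest; for [e = 1] this maximum is the lowest
   height [a] of the centre that keeps the lower hemisphere above the graph. *)
have [|||x0 Bx0 hm] := @EVT_min_rV R n (fun x => - s x - e * f x) (eclosed_ball c r).
- by exists c; exact: eclosed_ball_center.
- exact/compact_eclosed_ball/ltW.
- apply: continuous_within_ball => x Ux.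
  apply: (@continuousB _ _ _ (fun x => - s x) (fun x => e * f x)).
    apply: (@continuousN _ _ _ s).
    apply: (@continuous_comp _ _ _ (fun x => rho ^+ 2 - y x) Num.sqrt).
      apply: (@continuousB _ _ _ (cst (rho ^+ 2)) y); first exact: cst_continuous.
      exact: continuous_sqr_dist.
    exact: sqrt_continuous.
  apply: (@continuousM _ _ (cst e) f); first exact: cst_continuous.
  exact: C2_continuous.
rewrite inE in Bx0.
have s0 x : eclosed_ball c r x -> 0 < s x by move=> /ys; rewrite sqrtr_gt0.
have s2 x : eclosed_ball c r x -> s x ^+ 2 = rho ^+ 2 - y x.
  by move=> /ys /ltW; exact: sqr_sqrtr.
have sq (t : R) : t ^+ 2 = (e * t) ^+ 2 by rewrite exprMn e2 mul1r.
exists rho, x0, (f x0 + e * s x0); split.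
  by rewrite -(@ltr_pXn2r _ 2) ?nnegrE ?sqrtr_ge0 ?(ltW hr) // rhoE ltrDl.
split => //.
- by rewrite addrC addKr mulrA -expr2 e2 mul1r s0.
- by rewrite opprD addNKr sqrrN exprMn e2 mul1r s2 // addrC subrK.
(* Maximality at [x0] says that [e * (a - f x)] is at least [s x], which is positive; squaring keeps
   the inequality. *)
- move=> x Bx; rewrite -lerBlDl -s2 // sq.
  rewrite mulrBr mulrDr mulrA -expr2 e2 mul1r.
  have /hm : x \in eclosed_ball c r by rewrite inE.
  have := s0 _ Bx; nra.
- move=> yr; rewrite opprD addNKr sqrrN exprMn e2 mul1r s2 // /y yr rhoE addrC addKr.
  by rewrite /del -mulrA gtr_pMr ?exprn_gt0 // ltr_pdivrMl // mulr1 hM.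
Qed.

Lemma is_derive_sphere_line (x0 v : 'rV[R]_n) (a t : R) : U (x0 + t *: v) ->
  is_derive t 1
    (fun s => dot (x0 + s *: v - c) (x0 + s *: v - c) + (f (x0 + s *: v) - a) ^+ 2)
    (2 * (dot (x0 - c) v + t * dot v v) +
     2 * ((f (x0 + t *: v) - a) * dot (grad f (x0 + t *: v)) v)).
Proof.
move=> Ut.
have -> : (fun s => dot (x0 + s *: v - c) (x0 + s *: v - c) +
                    (f (x0 + s *: v) - a) ^+ 2) =
    (fun s => dot (x0 - c) (x0 - c) + s * (2 * dot (x0 - c) v + s * dot v v) +
              (f (x0 + s *: v) - a) ^+ 2).
  by apply/funext => s; rewrite [x0 + _ - c]addrAC dot_line.
exact/is_derive_quad_sqr/(is_derive_line_grad U f hf).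
Qed.

Lemma is_derive2_sphere_line (x0 v : 'rV[R]_n) (a : R) : U x0 ->
  is_derive (0 : R) 1
    (fun t => 2 * (dot (x0 - c) v + t * dot v v) +
     2 * ((f (x0 + t *: v) - a) * dot (grad f (x0 + t *: v)) v))
    (2 * dot v v + 2 * (dot (grad f x0) v * dot (grad f x0) v +
                        (f x0 - a) * dot (v *m hess x0) v)).
Proof.
move=> U0; have U00 : U (x0 + (0 : R) *: v) by rewrite scale0r addr0.
have := is_derive_affine_mul _ _ (dot (x0 - c) v) (dot v v) _ _ a _
  (is_derive_line_grad U f hf _ _ _ U00) (is_derive_line_hess U f hf _ _ v _ U00).
by rewrite scale0r addr0.
Qed.

(** The squared distance to the centre of the touching sphere is minimal at the contact point, and
    its second derivative there bounds the Hessian. The constant [k] is [1 / rho]. *)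
Lemma touching (e : R) : e ^+ 2 = 1 ->
  exists (k : R) (x : 'rV[R]_n),
    [/\ 0 < k, k < 1 / r, eclosed_ball c r x &
      forall v, e * dot (v *m hess x) v <=
        k * Num.sqrt (1 + dot (grad f x) (grad f x)) *
        (dot v v + dot (grad f x) v ^+ 2)].
Proof.
move=> e2; have [rho [x [a [rr [Bx ea xrho hmin hbd]]]]] := touching_sphere _ e2.
have rho0 : 0 < rho := lt_trans hr rr.
have Ux := hBU _ Bx.
set p := grad f x in hbd *.
have xr : dot (x - c) (x - c) <= r ^+ 2.
  by apply/eclosed_ballP; [exact: ltW | exact: Bx].
pose h v s := dot (x + s *: v - c) (x + s *: v - c) + (f (x + s *: v) - a) ^+ 2.
have h0 v : h v 0 = rho ^+ 2 by rewrite /h scale0r addr0.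
(* Contact over the boundary is impossible: moving towards [c] cannot decrease the distance, so
   [r ^+ 2 <= - d * b] in the notation below. With Cauchy-Schwarz this contradicts the steepness of
   the sphere. *)
have hin : dot (x - c) (x - c) < r ^+ 2.
  rewrite lt_neqAle xr andbT; apply/eqP => xE.
  have U0 : U (x + (0 : R) *: (- (x - c))) by rewrite scale0r addr0.
  have dh := is_derive_sphere_line x (- (x - c)) a 0 U0.
  have : 0 <= 2 * (dot (x - c) (- (x - c)) + 0 * dot (- (x - c)) (- (x - c))) +
      2 * ((f (x + (0 : R) *: (- (x - c))) - a) *
           dot (grad f (x + (0 : R) *: (- (x - c)))) (- (x - c))).
    rewrite leNgt; apply/negP => /(derive_lt0_decr _ _ dh)[e' e'0 he'].
    pose t := Num.min e' 1 / 2.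
    have t0 : 0 < t by rewrite divr_gt0 // lt_min e'0 ltr01.
    have : t < Num.min e' 1 by rewrite ltr_pdivrMr // ltr_pMr ?ltr1n // lt_min e'0 ltr01.
    rewrite lt_min => /andP[te t1].
    have := he' t t0 te; apply/negP; rewrite -leNgt -!/(h _ _) h0; apply: hmin.
    apply/eclosed_ballP; first exact: ltW.
    rewrite scalerN addrAC -{1 3}[x - c]scale1r -scalerBl dotZl dotC dotZl xE.
    have := sqr_ge0 r; nra.
  rewrite scale0r addr0 mul0r addr0 ![dot _ (- _)]dotC !dotNl xE [dot (x - c) _]dotC -/p.
  have := hbd xE; have := cauchy_schwarz _ p (x - c); rewrite xE.
  set b := dot p (x - c); set q := dot p p; set d := f x - a.
  move=> h1 h2 h3.
  have h4 : r ^+ 2 <= - d * b by lra.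
  have r20 : 0 < r ^+ 2 by rewrite exprn_gt0.
  have : r ^+ 2 * r ^+ 2 <= (- d * b) * (- d * b) by apply: ler_pM => //; rewrite ltW.
  have : d ^+ 2 * b ^+ 2 <= d ^+ 2 * (q * r ^+ 2) by rewrite ler_wpM2l ?sqr_ge0.
  have : d ^+ 2 * q * r ^+ 2 < r ^+ 2 * r ^+ 2 by rewrite ltr_pM2r.
  lra.
have near_sphere v : \forall t \near (0 : R), is_derive (t : R) 1 (h v)
    (2 * (dot (x - c) v + t * dot v v) +
     2 * ((f (x + t *: v) - a) * dot (grad f (x + t *: v)) v)).
  by near=> t; apply: is_derive_sphere_line; near: t; exact: near_line.
have near_min v : \forall t \near (0 : R), h v 0 <= h v t.
  have oV : open ((fun y : 'rV[R]_n => dot (y - c) (y - c)) @^-1` [set z | z < r ^+ 2]).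
    by apply: open_comp => [y _|]; [exact: continuous_sqr_dist | exact: open_lt].
  near=> t; rewrite h0; apply: hmin; apply/eclosed_ballP; first exact: ltW.
  by apply: ltW; near: t; exact: (near_line _ oV).
have test v : dot (x - c) v + (f x - a) * dot p v = 0 /\
    0 <= dot v v + (dot p v * dot p v + (f x - a) * dot (v *m hess x) v).
  have := second_derivative_test _ _ _ (near_sphere v)
    (is_derive2_sphere_line x v a Ux) (near_min v).
  rewrite scale0r addr0 mul0r addr0 -!mulrDr -/p => -[h1 h2].
  split; first by move/eqP: h1; rewrite mulf_eq0 pnatr_eq0 /= => /eqP.
  by move: h2; rewrite pmulr_rge0.
pose s := e * (a - f x).
have fs : f x - a = - (e * s).
  by rewrite /s mulrA -expr2 e2 mul1r opprB.
(* The first-order condition makes [x - c] equal to [e * s] times [p]; testing it on [x - c] and on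
   [p] gives the lengths. *)
have rhoE : rho ^+ 2 = s ^+ 2 * (1 + dot p p).
  have [] := test (x - c); have [] := test p; rewrite fs -xrho fs => h1 _ h2 _.
  rewrite sqrrN exprMn e2 mul1r.
  move: h1 h2; rewrite [dot (x - c) p]dotC => h1 h2.
  have : dot (x - c) (x - c) = (e * s) ^+ 2 * dot p p.
    rewrite expr2; have -> : dot (x - c) (x - c) = e * s * dot p (x - c) by lra.
    by rewrite -mulrA -[dot p (x - c)](_ : e * s * dot p p = _) //; lra.
  by rewrite exprMn e2 mul1r => ->; ring.
have q1 : 0 < 1 + dot p p by rewrite ltr_pwDl // dot_ge0.
have WE : rho = s * Num.sqrt (1 + dot p p).
  rewrite -[LHS]ger0_norm ?ltW // -sqrtr_sqr rhoE sqrtrM ?sqr_ge0 // sqrtr_sqr.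
  by rewrite ger0_norm // ltW.
exists rho^-1, x; split => //.
- by rewrite invr_gt0.
- by rewrite div1r ltf_pV2.
move=> v; have [_] := test v; rewrite fs.
have W0 : 0 < Num.sqrt (1 + dot p p) by rewrite sqrtr_gt0.
have -> : rho^-1 * Num.sqrt (1 + dot p p) = s^-1.
  by rewrite WE; field; rewrite !gt_eqF.
rewrite ler_pdivlMl // => ?; lra.
Unshelve. all: by end_near. Qed.

End Touching.

(** * Curvatures of the graph *)

Section Geometry.
Context {R : realType}.

Lemma dot_row_mx n (u v : 'rV[R]_n) (a b : R) :
  dot (row_mx u a%:M) (row_mx v b%:M : 'rV_(n + 1)) = dot u v + a * b.
Proof.
by rewrite !dotE tr_row_mx mul_row_col tr_scalar_mx -scalar_mxM [LHS]mxE
  [X in _ + X]mxE eqxx mulr1n.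
Qed.

Lemma derive_row_mx n (V : normedModType R) (F : V -> 'rV[R]_n) (g : V -> R) x v :
  derivable F x v -> derivable g x v ->
  'D_v (fun y => row_mx (F y) (g y)%:M : 'rV_(n + 1)) x =
    row_mx ('D_v F x) ('D_v g x)%:M.
Proof.
move=> dF dg.
have El k : (fun y => (row_mx (F y) (g y)%:M : 'rV_(n + 1)) 0 (lshift 1 k)) =
    (fun y => F y 0 k) by apply/funext => y; rewrite row_mxEl.
have Er k : (fun y => (row_mx (F y) (g y)%:M : 'rV_(n + 1)) 0 (rshift n k)) = g.
  by apply/funext => y; rewrite row_mxEr ord1 mxE eqxx mulr1n.
have dF' := (derivable_mxP _ _ _).1 dF.
rewrite derive_mx; last first.
  apply/derivable_mxP => i j; rewrite ord1; case: (split_ordP j) => k ->.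
    by rewrite El; exact: dF'.
  by rewrite Er; exact: dg.
apply/rowP => j; rewrite mxE; case: (split_ordP j) => k ->.
  by rewrite El row_mxEl derive_mx // mxE.
by rewrite Er row_mxEr ord1 mxE eqxx mulr1n.
Qed.

Section Graph.
Context {n : nat} (U : set 'rV[R]_n) (f : 'rV[R]_n -> R).
Hypotheses (hU : open U) (hf : C2_on U f).
Let hess x := jacobian (grad f) x.

Lemma partial_graph_map x i : U x ->
  partial (graph_map f) i x = row_mx (delta_mx 0 i) (grad f x 0 i)%:M.
Proof.
move=> Ux; have [df _ _] := hf.
rewrite /partial (derive_row_mx _ _ id f); last exact/diff_derivable/df.
  by rewrite derive_id mxE.
exact: derivable_id.
Qed.

Lemma partial2_graph_map x i j : U x ->
  partial (partial (graph_map f) i) j x = row_mx 0 (hess x j i)%:M.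
Proof.
move=> Ux; have [_ /(_ _ Ux) dg _] := hf.
have dg' : derivable (grad f) x (delta_mx 0 j) by exact: diff_derivable.
(* The formula for the first partial holds only on [U], which suffices for differentiating at a
   point of the open set [U]. *)
rewrite {1}/partial (@near_eq_derive _ _ _ _
    (fun y => row_mx (cst (delta_mx 0 i) y) (grad f y 0 i)%:M)); last first.
  have : nbhs x U by exact: open_nbhs_nbhs.
  by apply: filterS => y; exact: partial_graph_map.
rewrite derive_row_mx; [|exact: derivable_cst|exact: ((derivable_mxP _ _ _).1 dg')].
rewrite derive_cst; congr (row_mx _ _%:M).
have := deriveEjacobian (delta_mx 0 j) dg; rewrite derive_mx // -rowE.
by move=> /matrixP/(_ 0 i); rewrite !mxE.
Qed.

Lemma first_formE x : U x ->
  first_form f x = 1%:M + (grad f x)^T *m grad f x.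
Proof.
move=> Ux; apply/matrixP => i j; rewrite !mxE !partial_graph_map // dot_row_mx.
rewrite dot_delta mxE eqxx big_ord1 !mxE eq_sym /=; congr (_ + _).
Qed.

(** The second partials of the graph map are vertical, so only the last coordinate of the normal
    matters. Symmetry of the Hessian absorbs the transposed indices of the Jacobian. *)
Lemma second_formE N x : U x ->
  second_form f N x = N (graph_map f x) 0 (rshift n 0) *: hess x.
Proof.
move=> Ux; rewrite -[hess x](hess_sym _ _ hU hf x Ux); apply/matrixP => i j.
rewrite [LHS]mxE partial2_graph_map // [RHS]mxE [_^T _ _]mxE.
set w := N _; rewrite -[w in LHS]hsubmxK [rsubmx w]mx11_scalar dot_row_mx.
by rewrite dotE mul0mx mxE add0r [rsubmx w _ _]mxE mulrC.
Qed.

(** Orthogonality to the tangent vectors forces [w] to be [eta] times the vector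
    [(- grad f x, 1)]. *)
Lemma unit_normal_last (w : 'rV[R]_(n + 1)) x : U x ->
  enorm w = 1 -> (forall i, dot (partial (graph_map f) i x) w = 0) ->
  w 0 (rshift n 0) ^+ 2 * (1 + dot (grad f x) (grad f x)) = 1.
Proof.
move=> Ux w1 wn.
set eta := w 0 _; have [l wE] : exists l : 'rV_n, w = row_mx l eta%:M.
  exists (lsubmx w).
  by rewrite -[LHS](@hsubmxK _ _ n 1) [rsubmx w]mx11_scalar [rsubmx w _ _]mxE.
have lE : l = - eta *: grad f x.
  apply/rowP => i; have := wn i.
  rewrite partial_graph_map // [X in dot _ X]wE dot_row_mx dot_delta.
  by move/eqP; rewrite addr_eq0 mulrC -mulNr [RHS]mxE => /eqP.
have : dot w w = 1.
  have : 0 <= dot w w := dot_ge0 _ _.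
  by move: w1; rewrite /enorm => h /sqr_sqrtr <-; rewrite h expr1n.
rewrite [X in dot X X]wE dot_row_mx lE dotZl dotC dotZl => h.
by rewrite -[RHS]h; ring.
Qed.

End Graph.

End Geometry.

(** * Inequalities between mean and scalar curvature *)

Section Curvature.
Context {R : realType}.

(** Here [kap] is the curvature of the touching sphere, and the sign [tau] compares the side of
    contact with the given normal. *)
Lemma curvature_bounds n (k : 'I_n -> R) (tau kap : R) : (2 <= n)%N ->
  tau ^+ 2 = 1 -> 0 < kap -> (forall i, tau * k i <= kap) ->
  let H := n%:R^-1 * \sum_(i < n) k i in
  let S := 2 / (n%:R * (n%:R - 1)) *
    \sum_(i < n) \sum_(j < n | (i < j)%N) k i * k j in
  - S <= kap ^+ 2 + 2 * kap * `|H| /\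
  (0 < tau * \sum_(i < n) k i -> S <= kap ^+ 2).
Proof.
move=> n2 tau2 kap0 kle H S.
have N2 : 2 <= n%:R :> R by rewrite (ler_nat R 2).
have cs := sqr_sum_le _ _ k.
(* Both [S <= H ^+ 2] and [- kap ^+ 2 + 2 * kap * (tau * H) <= S] compare the
   square of a sum with a sum of squares: for [k] by Cauchy-Schwarz, and for
   the nonnegative numbers [kap - tau * k i] by dropping the cross terms. *)
have h2 : \sum_(i < n) (kap - tau * k i) ^+ 2 <= (\sum_(i < n) (kap - tau * k i)) ^+ 2.
  by apply: sum_sqr_le_sqr_sum => i; rewrite subr_ge0.
have s1le : tau * \sum_(i < n) k i <= n%:R * kap.
  rewrite mulr_sumr mulr_natl -[X in _ *+ X]card_ord -sumr_const.
  by apply: ler_sum => i _.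
have E1 : \sum_(i < n) (kap - tau * k i) = n%:R * kap - tau * \sum_(i < n) k i.
  by rewrite sumrB sumr_const card_ord mulr_natl mulr_sumr.
have E2 : \sum_(i < n) (kap - tau * k i) ^+ 2 =
    n%:R * kap ^+ 2 - 2 * kap * tau * \sum_(i < n) k i + \sum_(i < n) k i ^+ 2.
  have -> : n%:R * kap ^+ 2 = \sum_(i < n) kap ^+ 2.
    by rewrite sumr_const card_ord mulr_natl.
  rewrite !mulr_sumr -sumrB -big_split /=; apply: eq_bigr => i _.
  by rewrite sqrrB exprMn tau2 mul1r; congr (_ + _); congr (_ - _); ring.
have SE : n%:R * (n%:R - 1) * S = (\sum_(i < n) k i) ^+ 2 - \sum_(i < n) k i ^+ 2.
  rewrite -sum_lt_mul_sqr -[RHS]mulr_natl /S; field.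
  by rewrite subr_eq0 !gt_eqF //; lra.
have HE : \sum_(i < n) k i = n%:R * H.
  by rewrite /H; field; rewrite gt_eqF //; lra.
move: h2 cs s1le; rewrite E1 E2 HE; rewrite HE in SE; clear E1 E2 HE.
move: (\sum_(i < n) k i ^+ 2) SE => s2; clearbody H S; clear kle.
move: (n%:R : R) N2 => N N2 SE h2 cs s1le.
have NN : 0 < N * (N - 1) by apply: mulr_gt0; lra.
have SH : S <= H ^+ 2.
  rewrite -(ler_pM2l NN) SE.
  have N0 : 0 < N by lra.
  rewrite -(ler_pM2l N0); lra.
have Slow : - kap ^+ 2 + 2 * kap * (tau * H) <= S.
  rewrite -(ler_pM2l NN) SE.
  have t2 : (N * kap - tau * (N * H)) ^+ 2 =
      (N * kap) ^+ 2 - 2 * N * kap * tau * (N * H) + (N * H) ^+ 2.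
    by rewrite sqrrB exprMn [(tau * _) ^+ 2]exprMn tau2 mul1r; ring.
  by move: h2; rewrite t2; lra.
split.
- have tau1 : `|tau| = 1
    by apply/eqP; rewrite -sqrp_eq1 // real_normK ?num_real // tau2.
  have := ler_norm (- (tau * H)); rewrite normrN normrM tau1 mul1r.
  rewrite -(ler_pM2l kap0) => ?; lra.
(* The sign condition gives [0 < tau * H <= kap], hence [H ^+ 2 <= kap ^+ 2]. *)
- move=> tH; apply: (le_trans SH).
  have N0 : 0 < N by lra.
  have -> : H ^+ 2 = (tau * H) ^+ 2 by rewrite exprMn tau2 mul1r.
  move: tH s1le; rewrite mulrCA pmulr_rgt0 // ler_pM2l // => t0 tk.
  by rewrite ler_pXn2r // nnegrE ltW.
Qed.

End Curvature.

(** * Continuity of matrix expressions and intermediate values on the ball *)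

Section Continuity.
Context {R : realType}.

Lemma continuous_sum_at (T : topologicalType) (x : T) (I : Type) (r : seq I)
    (F : I -> T -> R) :
  (forall i, {for x, continuous (F i)}) ->
  {for x, continuous (fun y => \sum_(i <- r) F i y)}.
Proof.
move=> cF; apply: (@cvg_big _ _ _ _ _ _ _ (nbhs x)) => [|i _].
  exact: add_continuous.
exact: cF.
Qed.

Lemma continuous_mulmx_entry (T : topologicalType) (x : T) m n p
    (A : T -> 'M[R]_(m, n)) (B : T -> 'M[R]_(n, p)) :
  (forall i j, {for x, continuous (fun y => A y i j)}) ->
  (forall i j, {for x, continuous (fun y => B y i j)}) ->
  forall i j, {for x, continuous (fun y => (A y *m B y) i j)}.
Proof.
move=> cA cB i j.
have -> : (fun y => (A y *m B y) i j) = (fun y => \sum_k A y i k * B y k j).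
  by apply/funext => y; rewrite mxE.
by apply: continuous_sum_at => k; apply: cvgM; [exact: cA | exact: cB].
Qed.

Lemma continuous_mxtrace (T : topologicalType) (x : T) n (A : T -> 'M[R]_n) :
  (forall i j, {for x, continuous (fun y => A y i j)}) ->
  {for x, continuous (fun y => \tr (A y))}.
Proof. by move=> cA; apply: continuous_sum_at => i; exact: cA. Qed.

Lemma continuous_entry (T : topologicalType) (x : T) m n (A : T -> 'M[R]_(m, n)) i j :
  {for x, continuous A} -> {for x, continuous (fun y => A y i j)}.
Proof.
move=> cA; apply: (@continuous_comp _ _ _ A (fun M : 'M[R]_(m, n) => M i j) x cA).
exact: coord_continuous.
Qed.

(** The matrix is the inverse of the metric with its denominator cleared, as in [invmx_rank_one]. *)
Lemma continuous_rank_one (T : topologicalType) (x : T) n (p : T -> 'rV[R]_n) i j :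
  {for x, continuous p} ->
  {for x, continuous (fun y => ((1 + dot (p y) (p y))%:M - (p y)^T *m p y) i j)}.
Proof.
move=> cp.
have -> : (fun y => ((1 + dot (p y) (p y))%:M - (p y)^T *m p y) i j) =
    (fun y => (1 + dot (p y) (p y)) * (i == j)%:R - p y 0 i * p y 0 j).
  by apply/funext => y; rewrite !mxE big_ord1 !mxE mulr_natr.
have cpi k : {for x, continuous (fun y => p y 0 k)} by exact: continuous_entry.
apply: cvgB; last by apply: cvgM; exact: cpi.
apply: cvgM; last exact: cst_continuous.
by apply: cvgD; [exact: cst_continuous | exact: (continuous_dot _ _ _ _ _ cp cp)].
Qed.

Lemma continuous_sigma2 (T : topologicalType) (x : T) n (A : T -> 'M[R]_n) :
  (forall i j, {for x, continuous (fun y => A y i j)}) ->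
  {for x, continuous (fun y => \tr (A y) ^+ 2 - \tr (A y *m A y))}.
Proof.
move=> cA; have cT := continuous_mxtrace _ _ _ _ cA.
have -> : (fun y => \tr (A y) ^+ 2 - \tr (A y *m A y)) =
    (fun y => \tr (A y) * \tr (A y) - \tr (A y *m A y)).
  by apply/funext => y; rewrite expr2.
apply: cvgB; first by apply: cvgM; exact: cT.
exact: (continuous_mxtrace _ _ _ (fun y => A y *m A y)
  (continuous_mulmx_entry _ _ _ _ _ _ _ cA cA)).
Qed.

(** The ball is convex, so the one-variable theorem applies on the segment from [a] to [b]. *)
Lemma eclosed_ball_IVT n (c : 'rV[R]_n) r (g : 'rV[R]_n -> R) a b : 0 <= r ->
  (forall x, eclosed_ball c r x -> {for x, continuous g}) ->
  eclosed_ball c r a -> eclosed_ball c r b -> g a <= 0 -> 0 <= g b ->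
  exists2 z, eclosed_ball c r z & g z = 0.
Proof.
move=> r0 cg Ba Bb ga gb.
pose l (t : R) := a + t *: (b - a).
have Bl t : t \in `[0, 1]%R -> eclosed_ball c r (l t).
  rewrite in_itv /= => /andP[t0 t1]; apply/eclosed_ballP => //.
  move: Ba Bb => /(eclosed_ballP _ _ _ _ r0) Ba /(eclosed_ballP _ _ _ _ r0).
  have -> : b - c = (a - c) + 1 *: (b - a) by rewrite scale1r [RHS]addrC subrKA.
  have -> : l t - c = (a - c) + t *: (b - a) by rewrite /l addrAC.
  rewrite !dot_line; move: Ba (dot_ge0 _ (b - a)).
  move: (dot (a - c) (a - c)) (dot (a - c) (b - a)) (dot (b - a) (b - a)).
  move=> A B C hA hC hB.
  have t1' : 0 <= 1 - t by rewrite subr_ge0.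
  (* The chord of the quadratic exceeds it by [t * (1 - t) * C]. *)
  have := mulr_ge0 (mulr_ge0 t0 t1') hC.
  have := ler_wpM2l t1' hA; have := ler_wpM2l t0 hB.
  lra.
have [|||t t01 gt] := @IVT R (g \o l) 0 1 0 => //.
- apply: continuous_in_subspaceT => t; rewrite inE => /Bl /cg cgt.
  apply: (@continuous_comp _ _ _ l g t _ cgt).
  apply: (@continuousD _ _ _ (cst a) (fun t : R => t *: (b - a))).
    exact: cst_continuous.
  exact: scalel_continuous.
- rewrite /= /l scale0r scale1r addr0 addrC subrK.
  by rewrite ge_min le_max ga gb orbT.
by exists (l t); [exact: Bl | exact: gt].
Qed.

End Continuity.

(** * Principal curvatures in terms of the scaled shape operator *)

Section Curvatures.
Context {R : realType} {n : nat} (U : set 'rV[R]_n) (f : 'rV[R]_n -> R).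
Hypotheses (hU : open U) (hf : C2_on U f).
Let hess x := jacobian (grad f) x.
Let q x := 1 + dot (grad f x) (grad f x).

(* The shape operator is [eta / q] times this matrix, where [eta] is the last
   coordinate of the normal and [eta ^+ 2 = 1 / q]; unlike [eta] and the
   principal curvatures, its entries are visibly continuous. *)
Definition scaled_shape (f : 'rV[R]_n -> R) (x : 'rV[R]_n) : 'M[R]_n :=
  jacobian (grad f) x *m
    ((1 + dot (grad f x) (grad f x))%:M - (grad f x)^T *m grad f x).

Lemma continuous_scaled_shape x i j : U x ->
  {for x, continuous (fun y => scaled_shape f y i j)}.
Proof.
have [_ dg cJ] := hf => Ux; move: i j.
have cg : {for x, continuous (grad f)} by exact: (C2_continuous_grad _ _ hf _ Ux).
apply: continuous_mulmx_entry => i j; first exact/continuous_entry/cJ.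
exact: continuous_rank_one.
Qed.

Lemma continuous_trace_scaled x : U x ->
  {for x, continuous (fun y => \tr (scaled_shape f y))}.
Proof.
by move=> Ux; apply: continuous_mxtrace => i j; exact: continuous_scaled_shape.
Qed.

Lemma continuous_sigma2_scaled x : U x ->
  {for x, continuous (fun y => \tr (scaled_shape f y) ^+ 2 -
    \tr (scaled_shape f y *m scaled_shape f y))}.
Proof.
by move=> Ux; apply: continuous_sigma2 => i j; exact: continuous_scaled_shape.
Qed.

Lemma principal_curvatures_spectrum (N : 'rV[R]_(n + 1) -> 'rV[R]_(n + 1)) x : U x ->
  let eta := N (graph_map f x) 0 (rshift n 0) in
  let k := tnth (principal_curvatures f N x) in
  [/\ \sum_i k i = eta / q x * \tr (scaled_shape f x),
      \sum_i k i ^+ 2 = (eta / q x) ^+ 2 * \tr (scaled_shape f x *m scaled_shape f x) &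
      forall s kap, (forall v, s * (eta * dot (v *m hess x) v) <=
                          kap * (dot v v + dot (grad f x) v ^+ 2)) ->
        forall i, s * k i <= kap].
Proof.
move=> Ux eta k; pose p := grad f x.
have symB : (eta *: hess x)^T = eta *: hess x.
  by rewrite linearZ /= [(hess x)^T](hess_sym _ _ hU hf x Ux).
have [d [dchar dtr dtr2 dle]] := shape_spectrum p _ symB.
have AE : eta *: hess x *m invmx (1%:M + p^T *m p) = (eta / q x) *: scaled_shape f x.
  by rewrite invmx_rank_one -dotE -scalemxAr -!scalemxAl scalerA mulrC.
have [_ kchar] : [set k : n.-tuple R | sorted <=%R k /\
    char_poly (shape_operator f N x) = \prod_(a <- k) ('X - a%:P)]
    (principal_curvatures f N x).
  (* Sorting the eigenvalues [d] gives a member of the set, so the default value is not taken.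
     Unique factorisation then makes the curvatures a permutation of [d]. *)
  apply: xgetPex.
  exists [tuple of sort <=%R [tuple d i | i < n]]; split.
    exact: sort_le_sorted.
  rewrite (perm_big [tuple d i | i < n]) /=; last by rewrite perm_sort.
  by rewrite big_image /= /shape_operator (second_formE U) // (first_formE U).
have kd : perm_eq (principal_curvatures f N x) [seq d i | i : 'I_n].
  apply: prod_XsubC_eq; rewrite -kchar big_image /=.
  by rewrite /shape_operator (second_formE U) // (first_formE U).
have sumE (F : R -> R) : \sum_i F (k i) = \sum_i F (d i).
  by rewrite -(big_tuple _ _ _ xpredT F) (perm_big _ kd) big_image.
split.
- by rewrite (sumE id) dtr AE mxtraceZ.
- by rewrite (sumE (fun a => a ^+ 2)) dtr2 AE -scalemxAl -scalemxAr !mxtraceZ mulrA.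
- move=> s kap hs i.
  have : k i \in [seq d i | i : 'I_n] by rewrite -(perm_mem kd) mem_tnth.
  move=> /mapP[j _ ->]; apply: dle => v.
  by rewrite rank_one_form -scalemxAr -scalemxAl mxE -dotE.
Qed.

End Curvatures.

(** * The curvature estimate at a point of contact *)

Section Estimate.
Context {R : realType} {n : nat} (U : set 'rV[R]_n) (f : 'rV[R]_n -> R).
Hypotheses (hn : (2 <= n)%N) (hU : open U) (hf : C2_on U f).
Variables (c : 'rV[R]_n) (r : R) (N : 'rV[R]_(n + 1) -> 'rV[R]_(n + 1)).
Hypotheses (hr : 0 < r) (hBU : eclosed_ball c r `<=` U).
Hypothesis hN : unit_normal_field f (eclosed_ball c r) N.
Let B := eclosed_ball c r.
(** Continuous substitutes: [h] is the mean curvature up to a nonzero factor depending on the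
    normal, and [s] is the scalar curvature up to a positive one. *)
Let h x := \tr (scaled_shape f x).
Let s x := \tr (scaled_shape f x) ^+ 2 - \tr (scaled_shape f x *m scaled_shape f x).

Let q x := 1 + dot (grad f x) (grad f x).
Let eta x := N (graph_map f x) 0 (rshift n 0).

Lemma normal_last_sqr x : B x -> eta x ^+ 2 * q x = 1.
Proof.
move=> Bx; have [_ /(_ _ Bx)[N1 NT]] := hN.
exact: (unit_normal_last U f hf _ _ (hBU _ Bx) N1 NT).
Qed.

Lemma normal_scale_gt0 x : B x -> 0 < (eta x / q x) ^+ 2.
Proof.
move=> Bx; have q0 : 0 < q x by rewrite ltr_pwDl // dot_ge0.
have eta0 : eta x != 0.
  apply/eqP => eta0; have := normal_last_sqr _ Bx.
  by rewrite eta0 expr0n mul0r => /esym/eqP; rewrite oner_eq0.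
by rewrite exprn_even_gt0 //= mulf_neq0 // invr_neq0 // gt_eqF.
Qed.

Lemma scalar_curvatureE x : B x ->
  exists2 C : R, 0 < C & scalar_curvature f N x = C * s x.
Proof.
move=> Bx; have n0 : 0 < n%:R * (n%:R - 1) :> R.
  by rewrite mulr_gt0 ?subr_gt0 ?ltr0n ?ltr1n // (leq_trans _ hn).
exists ((n%:R * (n%:R - 1))^-1 * (eta x / q x) ^+ 2).
  by rewrite mulr_gt0 ?invr_gt0 // normal_scale_gt0.
have [k1 k2 _] := principal_curvatures_spectrum U f hU hf N _ (hBU _ Bx).
rewrite /scalar_curvature -[2 / _]mulrC -mulrA [2 * _]mulr_natl sum_lt_mul_sqr k1 k2.
by rewrite exprMn -mulrBr mulrA.
Qed.

(** The difference is a positive multiple of the sum of the squared principal curvatures. Hence [h]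
    has no zero where [s] is positive. *)
Lemma sigma2_le_sqr_trace x : B x -> s x <= h x ^+ 2.
Proof.
move=> Bx; rewrite /s gerBl.
have [_ k2 _] := principal_curvatures_spectrum U f hU hf N _ (hBU _ Bx).
rewrite -(pmulr_rge0 _ (normal_scale_gt0 _ Bx)) -k2.
by apply: sumr_ge0 => i _; exact: sqr_ge0.
Qed.

Lemma touching_curvatures (e : R) : e ^+ 2 = 1 -> exists (x : 'rV[R]_n) (k : R),
  [/\ 0 < k, k < 1 / r, B x,
      - scalar_curvature f N x <= k ^+ 2 + 2 * k * `|mean_curvature f N x| &
      0 < e * h x -> scalar_curvature f N x <= k ^+ 2].
Proof.
move=> e2; have [k [x [k0 kr Bx hk]]] := touching U f hU hf c r hr hBU _ e2.
exists x, k.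
have q0 : 0 < q x by rewrite ltr_pwDl // dot_ge0.
have eq1 := normal_last_sqr _ Bx.
pose W := Num.sqrt (q x); have W0 : 0 < W by rewrite sqrtr_gt0.
have W2 : W ^+ 2 = q x by rewrite sqr_sqrtr // ltW.
pose tau := e * eta x * W.
(* The factor [eta x * W] is the sign of the given normal relative to the upward one. *)
have tau2 : tau ^+ 2 = 1 by rewrite /tau !exprMn e2 mul1r W2.
have [k1 _ kle] := principal_curvatures_spectrum U f hU hf N _ (hBU _ Bx).
have eW : eta x ^+ 2 * W = W^-1.
  by apply: (mulIf (lt0r_neq0 W0)); rewrite mulVf ?gt_eqF // -mulrA -expr2 W2.
have {}kle := kle tau k _.
have [|b1 b2] := curvature_bounds n _ tau k hn tau2 k0 (kle _).
  move=> v; have -> : tau * (eta x * dot (v *m jacobian (grad f) x) v) =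
      W^-1 * (e * dot (v *m jacobian (grad f) x) v) by rewrite -eW /tau; ring.
  by rewrite ler_pdivrMl // mulrA [W * k]mulrC; exact: hk.
split=> [||||eh] //; apply: b2; rewrite k1.
(* The factor [eta x] occurs squared, so the sign condition involves only [e] and [h], not the
   choice of normal. *)
have -> : tau * (eta x / q x * h x) = W^-1 / q x * (e * h x).
  by rewrite -eW /tau; field; rewrite gt_eqF.
by apply: mulr_gt0 eh; rewrite divr_gt0 // invr_gt0.
Qed.

Lemma semidefinite_scalar_curvature_ge0 x :
  semidefinite_at f N x -> 0 <= scalar_curvature f N x.
Proof.
move=> sd; apply: mulr_ge0.
  apply: divr_ge0 => //; apply: mulr_ge0 => //.
  by rewrite subr_ge0 ler1n (leq_trans _ hn).
apply: sumr_ge0 => i _; apply: sumr_ge0 => j _.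
by case: sd => sd; [exact: mulr_ge0 | exact: mulr_le0].
Qed.

(** The first alternative implies both claims of the theorem; in the second, negative scalar
    curvature excludes semi-definite points. *)
Lemma scalar_curvature_estimate :
  (exists2 x, B x & `|scalar_curvature f N x| < 1 / r ^+ 2) \/
  (forall x, B x -> scalar_curvature f N x < 0) /\
  (exists2 x, B x & `|scalar_curvature f N x| <=
                    (`|mean_curvature f N x| + 1 / r) * (2 / r)).
Proof.
have r0 : 0 < 1 / r by rewrite divr_gt0.
have Bc : B c by exact: eclosed_ball_center.
have const_sign (g : 'rV[R]_n -> R) : (forall x, U x -> {for x, continuous g}) ->
    (forall x, B x -> g x != 0) -> forall x y, B x -> B y -> 0 < g x -> 0 < g y.
  move=> cg g0 x y Bx By gx; rewrite ltNge; apply/negP => gy.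
  have [|z /g0/eqP] // := eclosed_ball_IVT n c r g y x (ltW hr) _ By Bx gy (ltW gx).
  by move=> z /hBU; exact: cg.
have [[x Bx sx0]|/forall2NP sn0] := pselect (exists2 x, B x & s x = 0).
  left; exists x => //; have [C _ ->] := scalar_curvatureE _ Bx.
  by rewrite sx0 mulr0 normr0 divr_gt0 // exprn_gt0.
have {}sn0 x : B x -> s x != 0 by move=> Bx; apply/eqP => sx; case: (sn0 x).
have cs x : U x -> {for x, continuous s} by exact: continuous_sigma2_scaled.
have cN x : U x -> {for x, continuous (fun y => - s y)}.
  by move=> /cs csx; exact: (continuousN csx).
have sN0 x : B x -> - s x != 0 by move=> Bx; rewrite oppr_eq0 sn0.
have := sn0 _ Bc; rewrite neq_lt => /orP[sc|sc].
  have neg x : B x -> scalar_curvature f N x < 0.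
    move=> Bx; have [C C0 ->] := scalar_curvatureE _ Bx.
    rewrite (pmulr_rlt0 _ C0) -oppr_gt0.
    by apply: (const_sign _ cN sN0 c x Bc Bx); rewrite oppr_gt0.
  right; split => //.
  have [x [k [k0 kr Bx hS _]]] := touching_curvatures 1 (expr1n _ _).
  exists x => //; rewrite ltr0_norm ?neg //; apply: (le_trans hS).
  have := normr_ge0 (mean_curvature f N x); move: (`|_|) => H H0.
  have -> : 2 / r = 2 * (1 / r) by rewrite mulrA mulr1.
  move: (1 / r) r0 kr => i i0 ki.
  have : 0 <= H * (i - k) by rewrite mulr_ge0 // subr_ge0 ltW.
  have := mulr_ge0 H0 (ltW i0).
  have := ler_pM (ltW k0) (ltW k0) (ltW ki) (ltW ki); have := mulr_gt0 i0 i0; nra.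
have spos x : B x -> 0 < s x by move=> Bx; exact: (const_sign _ cs sn0 c x).
have hn0 x : B x -> h x != 0.
  move=> Bx; apply/eqP => hx; have := sigma2_le_sqr_trace _ Bx.
  by rewrite hx expr0n leNgt spos.
have ch x : U x -> {for x, continuous h} by exact: continuous_trace_scaled.
(* The sphere touches from the side given by the sign of [h] at [c]; as [h] has no zero, this is its
   sign at the contact point too. *)
left; have e2 : Num.sg (h c) ^+ 2 = 1 by rewrite sqr_sg hn0.
have [x [k [k0 kr Bx _ hS]]] := touching_curvatures _ e2.
exists x => //; have [C C0 SE] := scalar_curvatureE _ Bx.
have S0 : 0 < scalar_curvature f N x by rewrite SE; exact: (mulr_gt0 C0 (spos _ Bx)).
rewrite (gtr0_norm S0); apply: (@le_lt_trans _ _ (k ^+ 2)).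
  apply: hS; have := hn0 _ Bc; rewrite neq_lt => /orP[hc|hc].
    rewrite (ltr0_sg hc) mulN1r.
    have chN y : U y -> {for y, continuous (fun z => - h z)}.
      by move=> /ch cy; exact: (continuousN cy).
    apply: (const_sign _ chN _ c x Bc Bx); last by rewrite oppr_gt0.
    by move=> y By; rewrite oppr_eq0 hn0.
  by rewrite (gtr0_sg hc) mul1r; exact: (const_sign _ ch hn0 c x).
have -> : 1 / r ^+ 2 = (1 / r) ^+ 2 by rewrite expr_div_n expr1n.
by rewrite ltr_pXn2r // nnegrE ltW.
Qed.

End Estimate.

(** * Passage to the infimum and the supremum *)

Theorem theorem1p2 (R : realType) (n : nat) (hn : (2 <= n)%N)
  (c : 'rV[R]_n) (r : R) (hr : 0 < r)
  (U : set 'rV[R]_n) (hU : open U) (hBU : eclosed_ball c r `<=` U)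
  (f : 'rV[R]_n -> R) (hf : C2_on U f)
  (N : 'rV[R]_(n + 1) -> 'rV[R]_(n + 1))
  (hN : unit_normal_field f (eclosed_ball c r) N) :
  (ereal_inf [set `|scalar_curvature f N x|%:E | x in eclosed_ball c r]
    <= (ereal_sup [set `|mean_curvature f N x|%:E | x in eclosed_ball c r]
        + (1 / r)%:E) * (2 / r)%:E)%E /\
  ((exists2 x, eclosed_ball c r x & semidefinite_at f N x) ->
   (ereal_inf [set `|scalar_curvature f N x|%:E | x in eclosed_ball c r]
     < (1 / r ^+ 2)%:E)%E).
Proof.
have infR x : eclosed_ball c r x ->
    (ereal_inf [set `|scalar_curvature f N x|%:E | x in eclosed_ball c r]
      <= `|scalar_curvature f N x|%:E)%E.
  by move=> Bx; apply: ereal_inf_lbound; exists x.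
have part1 x : eclosed_ball c r x ->
    `|scalar_curvature f N x| <= (`|mean_curvature f N x| + 1 / r) * (2 / r) ->
    (ereal_inf [set `|scalar_curvature f N x|%:E | x in eclosed_ball c r]
    <= (ereal_sup [set `|mean_curvature f N x|%:E | x in eclosed_ball c r]
        + (1 / r)%:E) * (2 / r)%:E)%E.
  move=> Bx hx; apply: (le_trans (infR _ Bx)).
  apply: (@le_trans _ _ ((`|mean_curvature f N x|%:E + (1 / r)%:E) * (2 / r)%:E)%E).
    by rewrite -EFinD -EFinM lee_fin.
  apply: lee_wpmul2r; first by rewrite lee_fin divr_ge0 // ltW.
  by apply: leeD2r; apply: ereal_sup_ubound; exists x.
have [[x Bx hx]|[neg [x Bx hx]]] :=
  scalar_curvature_estimate U f hn hU hf c r N hr hBU hN.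
  (* The strict bound also gives the first claim, since [1 / r ^+ 2] is at most
     [(1 / r) * (2 / r)]. *)
  split=> [|_]; last by apply: le_lt_trans (infR _ Bx) _; rewrite lte_fin.
  apply: part1 Bx _; apply: (le_trans (ltW hx)).
  have ir : 0 < r^-1 by rewrite invr_gt0.
  rewrite !div1r -exprVn; have := normr_ge0 (mean_curvature f N x).
  move: (`|_|) (r^-1) ir => H i i0 H0.
  have := mulr_ge0 H0 (ltW i0); have := mulr_gt0 i0 i0; lra.
split; first exact: part1 Bx hx.
move=> [y By /(semidefinite_scalar_curvature_ge0 _ hn)].
by rewrite leNgt neg.
Qed.
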